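(* The Littlewood–Paley functions of the heat semigroups, defined by $$\mathfrak{g}_{\pm}(f)(n)=\Big(\int_0^{\infty}|t\,\partial_tT_{t,\pm}f(n)|^2\,\frac{dt}{t}\Big)^{1/2},\qquad n\in\mathbb{Z},$$ are not bounded from $\ell^2(\mathbb{Z})$ into itself.
   Context: For sequences $f$ on $\mathbb{Z}$ and $t\ge0$, $T_{t,\pm}f(n)=\sum_{j=0}^\infty e^{-t}\frac{t^j}{j!}f(n\pm j)$. ''Not bounded'' means that there is no constant $C$ with $\|\mathfrak{g}_\pm(f)\|_{\ell^2}\le C\|f\|_{\ell^2}$ for all $f\in\ell^2(\mathbb{Z})$; the assertion is made for each of the two signs. *)

(* Defs.v *)
From mathcomp Require Import all_boot all_order all_algebra.
From mathcomp Require Import all_classical all_reals all_analysis.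

Set Implicit Arguments.
Unset Strict Implicit.
Unset Printing Implicit Defensive.

Import Order.TTheory GRing.Theory Num.Theory.
Import numFieldNormedType.Exports.

Local Open Scope classical_set_scope.
Local Open Scope ring_scope.

Variant pm_sign := Plus | Minus.

Definition translate (s : pm_sign) (n : int) (j : nat) : int :=
  match s with Plus => n + j%:Z | Minus => n - j%:Z end.

(* The semigroups are meant for t >= 0. The series converges absolutely for
   every real t when f is bounded, so for f in l^2 the limit is the sum. *)
Definition heat (R : realType) (s : pm_sign) (t : R) (f : int -> R) (n : int) : R :=
  limn (series (fun j : nat => expR (- t) * (t ^+ j / j`!%:R) * f (translate s n j))).

(* Extended-real valued, since the integral may diverge. *)
Definition littlewood_paley (R : realType) (s : pm_sign) (f : int -> R) (n : int)
    : \bar R :=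
  sqrte (\int[@lebesgue_measure R]_(t in `]0%R, +oo[)
    (`|t * derive1 (fun u : R => heat s u f n) t| ^+ 2 / t)%R%:E)%E.

Definition l2norm (R : realType) (u : int -> \bar R) : \bar R :=
  sqrte (\esum_(n in [set: int]) (`|u n| ^+ 2))%E.

Definition in_l2 (R : realType) (f : int -> R) : Prop :=
  (l2norm (EFin \o f) < +oo)%E.

(* Real sequences: a bound over all complex sequences would in particular hold
   here, so the failure of l2_bounded covers the complex case too. *)
Definition l2_bounded (R : realType) (G : (int -> R) -> (int -> \bar R)) : Prop :=
  exists C : R, forall f : int -> R, in_l2 f ->
    (l2norm (G f) <= C%:E * l2norm (EFin \o f))%E.

(* Main.v *)
Require Import Defs.
From mathcomp Require Import all_boot all_order all_algebra.
From mathcomp Require Import all_classical all_reals all_analysis.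
From mathcomp Require Import zify ring lra.

Set Implicit Arguments.
Unset Strict Implicit.
Unset Printing Implicit Defensive.

Import Order.TTheory GRing.Theory Num.Theory.
Import numFieldNormedType.Exports.

Local Open Scope classical_set_scope.
Local Open Scope ring_scope.

(** Test the inequality on the indicator of a block of [N] consecutive integers
    ending (in the direction of the semigroup) at 0. At the point at distance
    [k < N] from that end, the heat extension is the Poisson distribution function
    [\sum_(i <= k) e^-t t^i / i!], whose [t]-derivative telescopes to
    [- e^-t t^k / k!]. Hence the squared Littlewood-Paley function there is the
    Gamma integral [\int t e^-2t t^2k / k!^2 dt = (2k+1)! / (4^(k+1) k!^2)], which
    grows like [sqrt k]. Its sum over the block is of order [N^(3/2)], while the
    squared norm of the block is [N]. *)

(** * Poisson distribution functions and Gamma integrals *)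

Section poisson_integral.
Context {R : realType}.
Implicit Types (c x : R) (k : nat).

(** Each new term contributes the derivative [c] times (term [k] minus term [k+1]), so the sum
    telescopes. The rate [c] is kept general because the heat extension needs [c = 1] and the
    integral of its squared derivative needs [c = 2]. *)
Lemma is_derive_poisson_cdf c x k :
  is_derive x 1
    (fun u => \sum_(i < k.+1) expR (- (c * u)) * ((c * u) ^+ i / i`!%:R))
    (- (c * (expR (- (c * x)) * ((c * x) ^+ k / k`!%:R)))).
Proof.
have dexp : is_derive x 1 (fun u : R => expR (- (c * u))) (- c * expR (- (c * x))).
  rewrite mulrC; apply: is_derive1_comp.
  by apply: is_derive_eq; rewrite /GRing.scale/= mulr1.
elim: k => [|k IH].
  under eq_fun do rewrite big_ord1 expr0 fact0 divr1 mulr1.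
  by rewrite expr0 fact0 divr1 mulr1 -mulNr.
under eq_fun do rewrite big_ord_recr/=.
have dpow : is_derive x 1 (fun u : R => (c * u) ^+ k.+1 / k.+1`!%:R)
    (c * ((c * x) ^+ k / k`!%:R)).
  have h : is_derive x 1 (fun u : R => c * u) c.
    by apply: is_derive_eq; rewrite /GRing.scale/= mulr1.
  rewrite (_ : (fun u => _) = (fun u => c * u) ^+ k.+1 * cst (k.+1`!%:R^-1 : R)); last first.
    by apply/funext => u; rewrite !fctE.
  have h' := is_deriveM (is_deriveX k.+1 h) (is_derive_cst (k.+1`!%:R^-1 : R) x 1).
  apply: (is_derive_eq h').
  rewrite scaler0 add0r /GRing.scale/= factS natrM invfM.
  have : (k.+1%:R : R) != 0 by rewrite pnatr_eq0.
  have : (k`!%:R : R) != 0 by rewrite pnatr_eq0 -lt0n fact_gt0.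
  by move=> h1 h2; field; rewrite h1 nat1r h2.
apply: (is_derive_eq (is_deriveD IH (is_deriveM dexp dpow))).
by rewrite /GRing.scale/=; ring.
Qed.

(** Keeping only the term of degree [k+1] in the exponential series bounds the expression by
    [(k+1) / (c u)]. *)
Lemma cvg_poisson_term c k : 0 < c ->
  expR (- (c * u)) * ((c * u) ^+ k / k`!%:R) @[u --> +oo] --> (0 : R).
Proof.
move=> c0.
apply: (@squeeze_cvgr _ _ _ _ (cst 0) (fun u => k.+1%:R * (c * u)^-1)).
- near=> u.
  have cu : 0 < c * u by rewrite mulr_gt0//.
  rewrite /cst mulr_ge0 ?expR_ge0 ?divr_ge0 ?exprn_ge0 ?(ltW cu)//=.
  have : (c * u) ^+ k.+1 / k.+1`!%:R <= expR (c * u).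
    by apply: le_trans (expR_ge1Dxn k (ltW cu)); rewrite lerDr.
  move=> h; rewrite expRN [leLHS]mulrC ler_pdivrMr ?expR_gt0//.
  apply: le_trans (_ : _ <= k.+1%:R * (c * u)^-1 * ((c * u) ^+ k.+1 / k.+1`!%:R)) _.
    have k1 : (k.+1%:R : R) != 0 by rewrite pnatr_eq0.
    have kf : (k`!%:R : R) != 0 by rewrite pnatr_eq0 -lt0n fact_gt0.
    rewrite factS natrM exprS le_eqVlt; apply/orP; left; apply/eqP.
    by field; rewrite kf nat1r k1 -negb_or orbC -mulf_eq0 gt_eqF.
  by rewrite ler_pM2l// divr_gt0// ltr0n.
- exact: cvg_cst.
- rewrite -[X in _ --> X](mulr0 (k.+1%:R : R)).
  apply: cvgMl_tmp.
  apply/gtr0_cvgV0.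
    by near=> u; rewrite mulr_gt0.
  exact: gt0_cvgMry.
Unshelve. all: by end_near. Qed.

Lemma continuous_poisson_term c k :
  continuous (fun u => expR (- (c * u)) * ((c * u) ^+ k / k`!%:R)).
Proof.
have hc : continuous (fun u : R => c * u).
  by move=> u; apply: cvgMl_tmp; exact: cvg_id.
move=> u; apply: cvgM.
  apply: (@continuous_comp _ _ _ (fun u => - (c * u)) expR).
    by apply: cvgN; exact: hc.
  exact: continuous_expR.
apply: cvgMr_tmp.
apply: (@continuous_comp _ _ _ (fun u => c * u) (fun v => v ^+ k)).
  exact: hc.
exact: exprn_continuous.
Qed.

Lemma continuous_gamma_density c k :
  continuous (fun t : R => c * (expR (- (c * t)) * ((c * t) ^+ k / k`!%:R))).
Proof. by move=> t; apply: cvgMl_tmp; exact: continuous_poisson_term. Qed.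

Lemma gamma_density_ge0 c k (t : R) : 0 <= c -> 0 <= t ->
  0 <= c * (expR (- (c * t)) * ((c * t) ^+ k / k`!%:R)).
Proof.
by move=> c0 t0; rewrite !mulr_ge0 ?invr_ge0 ?exprn_ge0 ?expR_ge0 ?mulr_ge0.
Qed.

(** Minus the Poisson distribution function is an antiderivative. It rises from [-1] at 0, where
    only the term [i = 0] survives, to 0 at infinity. *)
Lemma integral_gamma_density c k : 0 < c ->
  (\int[@lebesgue_measure R]_(t in `]0%R, +oo[)
     (c * (expR (- (c * t)) * ((c * t) ^+ k / k`!%:R)))%:E = 1)%E.
Proof.
move=> c0.
have cts := @continuous_gamma_density c k.
rewrite integral_itv_obnd_cbnd; last first.
  apply/measurable_realfun.measurable_EFinP; apply: measurable_funTS.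
  exact: measurable_realfun.continuous_measurable_fun.
pose F t : R := - \sum_(i < k.+1) expR (- (c * t)) * ((c * t) ^+ i / i`!%:R).
have dF (t : R) : is_derive t 1 F (c * (expR (- (c * t)) * ((c * t) ^+ k / k`!%:R))).
  by rewrite -[X in is_derive _ _ _ X]opprK; apply/is_deriveN/is_derive_poisson_cdf.
rewrite (@ge0_continuous_FTC2y _ _ F 0 0).
- rewrite /F big_ord_recl/= mulr0 oppr0 expR0 expr0 fact0 divr1 mulr1 big1.
    by rewrite addr0 -EFinB sub0r opprK.
  by move=> i _; rewrite expr0n mul0r mulr0.
- by move=> x x0; rewrite gamma_density_ge0// ltW.
- exact: continuous_subspaceT.
- rewrite -[X in _ --> X](oppr0 R); apply: cvgN.
  elim: (k.+1) => [|m IH].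
    rewrite (_ : (fun _ => _) = cst 0); first exact: cvg_cst.
    by apply/funext => t; rewrite big_ord0.
  rewrite -[X in _ --> X](addr0 (0 : R)).
  under eq_fun do rewrite big_ord_recr/=.
  by apply: cvgD => //; exact: cvg_poisson_term.
- by move=> x _; have [] := dF x.
- apply: cvg_at_right_filter; apply: differentiable_continuous.
  by apply/derivable1_diffP; have [] := dF 0.
- by move=> x _; rewrite derive1E; have /@derive_val := dF x.
Qed.

End poisson_integral.

(** * Growth of the Gamma integrals and of their sums *)

Section wallis.
Context {R : realType}.

(** This is [(2k+1) binom(2k,k) / 4^(k+1)], asymptotic to [sqrt(k / pi) / 2] by the Wallis
    product. *)
Definition wallis k : R := (k.*2.+1)`!%:R / (4 ^+ k.+1 * k`!%:R ^+ 2).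

Lemma wallis_ge0 k : 0 <= wallis k.
Proof. by rewrite /wallis divr_ge0// mulr_ge0// exprn_ge0. Qed.

Lemma wallisS k : wallis k.+1 = wallis k * ((2 * k%:R + 3) / (2 * k.+1%:R)).
Proof.
rewrite /wallis doubleS !factS !natrM exprS.
have e : (k.*2.+3%:R : R) = 2 * k%:R + 3 by rewrite -mul2n -addn3 natrD natrM.
have e' : (k.*2.+2%:R : R) = 2 * k.+1%:R by rewrite -doubleS -mul2n natrM.
rewrite e e'.
have : (k.+1%:R : R) != 0 by rewrite pnatr_eq0.
have : (k`!%:R : R) != 0 by rewrite pnatr_eq0 -lt0n fact_gt0.
have : (4 ^+ k.+1 : R) != 0 by rewrite expf_neq0 ?pnatr_eq0.
by move=> h0 h1 h2; field; rewrite h0 h1 nat1r h2.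
Qed.

(** By the ratio in [wallisS], the right-hand side grows by [((2N+3)/3 - 2N/3) wallis N = wallis N]
    from [N] to [N+1]. *)
Lemma sum_wallis N : \sum_(k < N) wallis k = 2 / 3 * N%:R * wallis N.
Proof.
elim: N => [|N IH]; first by rewrite big_ord0 mulr0 mul0r.
rewrite big_ord_recr/= IH wallisS -natr1.
have : (N%:R + 1 : R) != 0 by rewrite natr1 pnatr_eq0.
by move=> h; field.
Qed.

(** An elementary substitute for the Wallis asymptotics, squared to avoid roots. The constant 1/16
    gives equality at [k = 0]. *)
Lemma sqr_wallis_ge k : k.+1%:R / 16 <= wallis k ^+ 2.
Proof.
elim: k => [|k IH].
  by rewrite /wallis fact0 factS fact0 expr1n mul1n expr1; lra.
rewrite wallisS exprMn.
have k0 : (0 : R) < k.+1%:R by rewrite ltr0n.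
apply: le_trans (_ : k.+1%:R / 16 * ((2 * k%:R + 3) / (2 * k.+1%:R)) ^+ 2 <= _); last first.
  by rewrite ler_wpM2r ?sqr_ge0.
rewrite -subr_ge0 -[k.+2%:R]natr1.
have -> : (k%:R : R) = k.+1%:R - 1 by rewrite -natr1 addrK.
(* With [m = k+1] the gap is [((2m+1)^2 - 4m(m+1)) / (64m)], whose numerator is 1. *)
rewrite (_ : _ - _ = (64 * k.+1%:R)^-1); last by field; rewrite gt_eqF.
by rewrite invr_ge0 mulr_ge0// ltW.
Qed.

End wallis.

(** The numbering starts at 0 and runs against the direction of the semigroup, so a translation by
    [j <= k] takes index [k] to index [k - j], and a longer one leaves the block past 0. *)
Definition mirror (s : pm_sign) (k : nat) : int :=
  match s with Plus => - k%:Z | Minus => k%:Z end.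

Lemma mirror_inj s : injective (mirror s).
Proof. by case: s => m n /=; [move/oppr_inj|]; case. Qed.

Lemma translate_mirror_block s N k j : (k < N)%N ->
  (translate s (mirror s k) j \in mirror s @` `I_N) = (j <= k)%N.
Proof.
move=> kN; apply/idP/idP => [|jk].
  by rewrite inE => -[i /= _]; case: s => /=; lia.
rewrite inE; exists (k - j)%N => /=; first exact: leq_ltn_trans (leq_subr _ _) kN.
by case: s => /=; lia.
Qed.

(** * The Littlewood-Paley function of a block *)

Section heat_block.
Context {R : realType} (s : pm_sign) (N : nat).

Let block : int -> R := \1_(mirror s @` `I_N).

(** Translations beyond [k] leave the block, so the partial sums are constant from [k+1] terms on.
    The factor [1 * u] matches [is_derive_poisson_cdf] at rate 1. *)
Lemma heat_block k (u : R) : (k < N)%N ->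
  heat s u block (mirror s k) =
  \sum_(i < k.+1) expR (- (1 * u)) * ((1 * u) ^+ i / i`!%:R).
Proof.
move=> kN; rewrite /heat; apply: lim_near_cst => //.
near=> n.
have kn : (k < n)%N by near: n; exact: nbhs_infty_gt.
rewrite /series/= (big_cat_nat (leq0n k.+1) kn)/= [X in _ + X]big_nat_cond [X in _ + X]big1.
  rewrite addr0 big_mkord; apply: eq_bigr => i _.
  by rewrite /block indicE translate_mirror_block// -ltnS ltn_ord mulr1 mul1r.
move=> i /andP[/andP[ki _] _].
by rewrite /block indicE translate_mirror_block// leqNgt ki mulr0.
Unshelve. all: by end_near. Qed.

(** The integrand is [t e^(-2t) t^(2k) / k!^2], which is [wallis k] times the Gamma density of rate
    2 and shape [2k+2], of total mass 1. *)
Lemma littlewood_paley_block k : (k < N)%N ->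
  littlewood_paley s block (mirror s k) = sqrte (wallis k)%:E.
Proof.
move=> kN; rewrite /littlewood_paley; congr sqrte.
transitivity (\int[@lebesgue_measure R]_(t in `]0%R, +oo[)
  ((wallis k)%:E * (2 * (expR (- (2 * t)) *
      ((2 * t) ^+ k.*2.+1 / (k.*2.+1)`!%:R)))%:E))%E.
  apply: eq_integral => t; rewrite inE/= in_itv/= andbT => t0.
  have -> : (fun u => heat s u block (mirror s k)) =
     (fun u => \sum_(i < k.+1) expR (- (1 * u)) * ((1 * u) ^+ i / i`!%:R)).
    by apply/funext => u; rewrite heat_block.
  rewrite derive1E; have /@derive_val -> := is_derive_poisson_cdf 1 t k.
  rewrite -EFinM; congr EFin; rewrite !mul1r real_normK ?num_real// /wallis.
  have -> : expR (- (2 * t)) = expR (- t) ^+ 2.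
    by rewrite expr2 -expRD; congr expR; ring.
  have -> : (4 : R) ^+ k.+1 = 2 * 2 ^+ k.*2.+1.
    by rewrite -exprS -doubleS -mul2n exprM; congr (_ ^+ _); rewrite expr2; lra.
  rewrite [(2 * t) ^+ _]exprMn -[in t ^+ _.+1]muln2 [t ^+ _.+1]exprS exprM.
  have : (k`!%:R : R) != 0 by rewrite pnatr_eq0 -lt0n fact_gt0.
  have : ((k.*2.+1)`!%:R : R) != 0 by rewrite pnatr_eq0 -lt0n fact_gt0.
  have : (2 ^+ k.*2.+1 : R) != 0 by rewrite expf_neq0 ?pnatr_eq0.
  have : t != 0 by rewrite gt_eqF.
  set A := 2 ^+ _; set B := _`!%:R; set D := _`!%:R => h1 h2 h3 h4.
  by field; rewrite h1 h2 h3 h4.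
rewrite ge0_integralZl_EFin//=.
- by rewrite integral_gamma_density// mule1.
- move=> t; rewrite in_itv/= andbT => t0.
  by rewrite lee_fin gamma_density_ge0// ltW.
- apply/measurable_realfun.measurable_EFinP; apply: measurable_funTS.
  apply: measurable_realfun.continuous_measurable_fun.
  exact: continuous_gamma_density.
- exact: wallis_ge0.
Qed.

Lemma esum_block (a : int -> \bar R) : (forall n, 0 <= a n)%E ->
  (\esum_(n in mirror s @` `I_N) a n = \sum_(k < N) a (mirror s k))%E.
Proof.
move=> a0; rewrite (@reindex_esum _ _ _ `I_N _ (mirror s)); last first.
  by apply: inj_bij => i j _ _; exact: mirror_inj.
by rewrite esum_fset// -fsbig_ord.
Qed.

Lemma l2norm_block : l2norm (EFin \o block) = sqrte N%:R%:E.
Proof.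
rewrite /l2norm; congr sqrte.
transitivity (\esum_(n in mirror s @` `I_N) (1 : \bar R))%E.
  rewrite [RHS]esum_mkcond; apply: eq_esum => n _ /=.
  rewrite /block indicE; case: (n \in _) => /=.
    by rewrite normr1 mule1. 
  by rewrite normr0 mule0.
rewrite esum_block// sumEFin sumr_const card_ord.
by [].
Qed.

(** All terms are nonnegative, so dropping the points outside the block leaves a lower bound. *)
Lemma l2norm_littlewood_paley_block :
  (sqrte (\sum_(k < N) wallis k)%:E <= l2norm (littlewood_paley s block))%E.
Proof.
rewrite /l2norm lee_sqrt ?esum_ge0//; last first.
  by move=> n _; rewrite expe2 mule_ge0// abse_ge0.
apply: le_trans (_ : \esum_(n in mirror s @` `I_N) (`|littlewood_paley s block n| ^+ 2) <= _)%E.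
  rewrite esum_block; last by move=> n; rewrite expe2 mule_ge0// abse_ge0.
  rewrite -sumEFin; apply: lee_sum => k _.
  by rewrite littlewood_paley_block// gee0_abs ?sqrte_ge0// sqr_sqrte ?lee_fin ?wallis_ge0.
rewrite esum_mkcond; apply: le_esum => n _; case: ifP => // _.
by rewrite expe2 mule_ge0// abse_ge0.
Qed.

End heat_block.

Theorem claim2 (R : realType) (s : pm_sign) : ~ l2_bounded (@littlewood_paley R s).
Proof.
case=> C boundC.
(* Boundedness will give [wallis N <= 3/2 C^2], while [wallis N ^+ 2 >= (N+1)/16]. Together these
   force [N + 1 <= 16 * 9/4 * C^4 = 36 C^4]. *)
pose N := Num.bound (36 * C ^+ 4).
have C4 : 0 <= 36 * C ^+ 4 by rewrite mulr_ge0// exprn_even_ge0.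
have ltN : 36 * C ^+ 4 < N%:R by exact: archi_boundP.
have N0 : 0 < N%:R :> R by exact: le_lt_trans ltN.
have sumC : \sum_(k < N) wallis k <= C ^+ 2 * N%:R :> R.
  have : in_l2 (\1_(mirror s @` `I_N) : int -> R).
    by rewrite /in_l2 l2norm_block ltry.
  move=> /boundC; rewrite l2norm_block.
  move=> /(le_trans (l2norm_littlewood_paley_block s N)); rewrite lee_fin => h.
  have S0 : 0 <= \sum_(k < N) wallis k :> R.
    by rewrite sumr_ge0// => k _; exact: wallis_ge0.
  rewrite -(sqr_sqrtr S0) -[in leRHS](sqr_sqrtr (ltW N0)) -exprMn.
  (* The sign of [C] is not given: the right side is nonnegative because by [h] it dominates a
     square root, and so squaring is legitimate. *)
  by rewrite ler_pXn2r ?nnegrE ?sqrtr_ge0 ?(le_trans _ h) ?sqrtr_ge0.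
have wC : wallis N <= 3 / 2 * C ^+ 2.
  rewrite -(ler_pM2l N0) -(ler_pM2l (_ : 0 < 2 / 3)) ?divr_gt0//.
  by move: sumC; rewrite sum_wallis; lra.
have := sqr_wallis_ge (R := R) N.
apply/negP; rewrite -ltNge.
apply: le_lt_trans (_ : (3 / 2 * C ^+ 2) ^+ 2 < _).
  by rewrite ler_pXn2r ?nnegrE ?wallis_ge0 ?(le_trans _ wC) ?wallis_ge0.
rewrite -natr1; move: ltN; rewrite exprMn -exprM; lra.
Qed.
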